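(* Let $L$ be a non-abelian finite-dimensional Lie algebra over a finite field $\mathbb{F}_q$. Then the girth of the non-commuting graph $G_L$ equals $3$.
   Context: $\mathbb{F}_q$ denotes the finite field with $q$ elements. For a Lie algebra $L$, $Z(L)=\{x\in L : [x,y]=0 \text{ for all } y\in L\}$ is its centre. The non-commuting graph $G_L$ is the undirected simple graph with vertex set $L\setminus Z(L)$, in which two distinct vertices $x$ and $y$ are adjacent if and only if $[x,y]\neq 0$. The girth of a graph is the length of its shortest cycle. *)

(* Defs.v *)
From HB Require Import structures.
From mathcomp Require Import all_boot all_order all_algebra all_field.

Set Implicit Arguments.
Unset Strict Implicit.
Unset Printing Implicit Defensive.

Import GRing.Theory.
Local Open Scope ring_scope.

(* The bracket is alternating ([x, x] = 0), not merely antisymmetric: the two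
   differ in characteristic 2. *)
HB.mixin Record Lmodule_isLieAlgebra (K : fieldType) L of GRing.Lmodule K L := {
  lie : L -> L -> L;
  lie_linearl : forall y : L, linear (fun x : L => lie x y);
  lie_linearr : forall x : L, linear (lie x);
  liexx : forall x : L, lie x x = 0;
  lie_jacobi : forall x y z : L,
    lie x (lie y z) + lie y (lie z x) + lie z (lie x y) = 0
}.

#[short(type="lieAlgType")]
HB.structure Definition LieAlgebra (K : fieldType) :=
  { L of GRing.Lmodule K L & Lmodule_isLieAlgebra K L }.

#[short(type="finDimLieAlgType")]
HB.structure Definition FinDimLieAlgebra (K : fieldType) :=
  { L of Vector K L & Lmodule_isLieAlgebra K L }.

Lemma lieC (K : fieldType) (L : lieAlgType K) (x y : L) :
  lie x y = - lie y x.
Proof.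
have addl (u v w : L) : lie (u + v) w = lie u w + lie v w.
  by have := lie_linearl w 1 u v; rewrite !scale1r.
have addr (u v w : L) : lie u (v + w) = lie u v + lie u w.
  by have := lie_linearr u 1 v w; rewrite !scale1r.
have := liexx (x + y); rewrite addl !addr !liexx add0r addr0.
by move/eqP; rewrite addr_eq0 => /eqP.
Qed.

Definition lie_abelian (K : fieldType) (L : lieAlgType K) : Prop :=
  forall x y : L, lie x y = 0.

Record simple_graph (T : finType) := SimpleGraph {
  adj :> rel T;
  adj_sym : symmetric adj;
  adj_irrefl : irreflexive adj
}.

Definition graph_cycle (T : finType) (G : simple_graph T) (c : seq T) : Prop :=
  (3 <= size c)%N /\ ucycle G c.

(* [has_girth G g] : the girth of [G] is the natural number [g]; no [g]
   qualifies when [G] is acyclic (infinite girth). *)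
Definition has_girth (T : finType) (G : simple_graph T) (g : nat) : Prop :=
  (exists2 c : seq T, graph_cycle G c & size c = g) /\
  (forall c : seq T, graph_cycle G c -> (g <= size c)%N).

Section NonCommutingGraph.
Variables (F : finFieldType) (L : finDimLieAlgType F).

(* [finvect_type L] is [L] itself, carrying the finType structure that comes
   from the finiteness of [F]. *)
Definition lie_center : {set finvect_type L} :=
  [set x : finvect_type L |
    [forall y : finvect_type L, lie (x : L) (y : L) == 0]].

Definition ncg_vertex : finType := {x : finvect_type L | x \notin lie_center}.

Definition ncg_adj : rel ncg_vertex :=
  fun x y => (x != y) && (lie (val x : L) (val y : L) != 0).

Fact ncg_adj_sym : symmetric ncg_adj.
Proof. by move=> x y; rewrite /ncg_adj eq_sym lieC oppr_eq0. Qed.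

Fact ncg_adj_irrefl : irreflexive ncg_adj.
Proof. by move=> x; rewrite /ncg_adj eqxx. Qed.

Definition non_commuting_graph : simple_graph ncg_vertex :=
  SimpleGraph ncg_adj_sym ncg_adj_irrefl.

End NonCommutingGraph.

(* Main.v *)
Require Import Defs.
From mathcomp Require Import all_boot all_order all_algebra all_field.

Set Implicit Arguments.
Unset Strict Implicit.
Unset Printing Implicit Defensive.

Import GRing.Theory.
Local Open Scope ring_scope.

(** No cycle is shorter than a triangle, so it suffices to find a triangle in
    the non-commuting graph. Non-abelianness gives [x] and [y] with
    [lie x y != 0]; since the bracket is alternating,
    [lie x (x + y) = lie x y = lie (x + y) y], so [x], [y] and [x + y] pairwise
    fail to commute. Non-commuting elements are automatically distinct and
    non-central, hence these three are the vertices of a triangle. The argument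
    works over every finite field, the two-element one included, because the
    only coefficients it uses are [0] and [1]. *)

Lemma lieDl (K : fieldType) (L : lieAlgType K) (x y z : L) :
  lie (x + y) z = lie x z + lie y z.
Proof. by have := lie_linearl z 1 x y; rewrite !scale1r. Qed.

Lemma lieDr (K : fieldType) (L : lieAlgType K) (x y z : L) :
  lie x (y + z) = lie x y + lie x z.
Proof. by have := lie_linearr x 1 y z; rewrite !scale1r. Qed.

Lemma lie_neq0_sym (K : fieldType) (L : lieAlgType K) (x y : L) :
  lie x y != 0 -> lie y x != 0.
Proof. by rewrite lieC oppr_eq0. Qed.

Section NonCommutingGraphTheory.
Variables (F : finFieldType) (L : finDimLieAlgType F).

Lemma lie_neq0_notin_center (x y : L) :
  lie x y != 0 -> (x : finvect_type L) \notin lie_center L.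
Proof.
by apply: contra; rewrite inE => /forallP/(_ (y : finvect_type L)).
Qed.

(** The bracket vanishes on the diagonal, so non-commuting vertices are distinct. *)
Lemma ncg_adjE (u v : ncg_vertex L) :
  ncg_adj u v = (lie (val u : L) (val v : L) != 0).
Proof.
by rewrite /ncg_adj; case: eqVneq => //= ->; rewrite liexx eqxx.
Qed.

Lemma not_abelian_lie_neq0 :
  ~ lie_abelian L -> exists x y : L, lie x y != 0.
Proof.
move=> nabL.
(* The carrier is finite, so the witnesses are found by a decidable search. *)
have [/existsP[x /existsP[y xy]]|/existsPn h] := boolP
    [exists x : finvect_type L, exists y : finvect_type L,
      lie (x : L) (y : L) != 0]; first by exists x, y.
case: nabL => x y; apply/eqP.
by have /existsPn/(_ (y : finvect_type L)) := h (x : finvect_type L);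
  rewrite negbK.
Qed.

End NonCommutingGraphTheory.

Theorem proposition2p5 (F : finFieldType) (L : finDimLieAlgType F) :
  ~ lie_abelian L -> has_girth (non_commuting_graph L) 3.
Proof.
move=> /not_abelian_lie_neq0 [x [y xy]].
split; last by move=> c [].
have yz : lie y (x + y) != 0.
  by rewrite lieDr liexx addr0; apply: lie_neq0_sym.
have zx : lie (x + y) x != 0.
  by rewrite lieDl liexx add0r; apply: lie_neq0_sym.
pose u : ncg_vertex L := Sub (x : finvect_type L) (lie_neq0_notin_center xy).
pose v : ncg_vertex L := Sub (y : finvect_type L) (lie_neq0_notin_center yz).
pose w : ncg_vertex L :=
  Sub (x + y : finvect_type L) (lie_neq0_notin_center zx).
have uv : ncg_adj u v by rewrite ncg_adjE.
have vw : ncg_adj v w by rewrite ncg_adjE.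
have wu : ncg_adj w u by rewrite ncg_adjE.
exists [:: u; v; w] => //; split=> //.
apply/andP; split; first by rewrite /= uv vw wu.
case/andP: uv => uv _; case/andP: vw => vw _; case/andP: wu => wu _.
by rewrite /= !inE negb_or uv vw eq_sym wu.
Qed.
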